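(* Let $N,d\ge 1$ and let $f_1,\dots,f_N:\mathbb R^d\to\mathbb R$ be convex functions such that $L_i:=\sup_{z\in\mathbb R^d}\sup_{g\in\partial f_i(z)}\|g\|_1<\infty$ for each $i$, and such that $f:=\sum_{i=1}^N f_i$ has at least one minimizer on $\mathbb R^d$. Let $P(t)=(p_{ij}(t))$, $t=0,1,2,\dots$, be $N\times N$ row-stochastic matrices, let $\Delta(t)=\operatorname{diag}(\delta_1(t),\dots,\delta_N(t))$ with real $\delta_i(t)$, and let $x_i(t)\in\mathbb R^d$ ($1\le i\le N$, $t\ge 0$) satisfy $$x_i(t+1)=\sum_{j=1}^N p_{ij}(t)x_j(t)-\delta_i(t)g_i(t),\qquad g_i(t)\in\partial f_i(x_i(t)),\qquad 1\le i\le N,\ t\ge 0,$$ with arbitrary initial data $x_i(0)\in\mathbb R^d$. Suppose that the following hold. (A1) $p^+:=\inf_{t\ge 0}\big[\min_{i,j:\,p_{ij}(t)>0}p_{ij}(t)\big]>0$, and there exists $T\in\mathbb N$ such that $P(t+T,t)>0$ for all $t\ge 0$. (A2) $\delta_i(t)\ge 0$ for all $i,t$, and $\sum_{t=0}^\infty\big(\|\Delta(t)\|\sup_{\ell\ge t}\|\Delta(\ell)\|\big)<\infty$. (A3) The set of absolute probability vectors $\pi(t)=(\pi_1(t),\dots,\pi_N(t))^\top$, $t\ge 0$, for $\{P(t)\}_{t\ge 0}$ (which exists and is unique under (A1)) satisfies $\sum_{t=0}^\infty\|\Delta(t)\pi(t+1)\|=\infty$ and $\sum_{t=0}^\infty\sqrt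 t\,\max_{i,j}|\pi_i(t+1)\delta_i(t)-\pi_j(t+1)\delta_j(t)|<\infty$. Then there exists a minimizer $x^*$ of $f$ such that $\lim_{t\to\infty}x_i(t)=x^*$ for all $1\le i\le N$.
   Context: A nonnegative square matrix is row-stochastic if each of its rows sums to $1$. For a matrix $A$, $A>0$ means every entry is positive. $\partial f_i(z)$ is the (convex) subdifferential of $f_i$ at $z$, and $\|g\|_1=\sum_l|g_l|$. Backward products: $P(t,t_0):=P(t-1)P(t-2)\cdots P(t_0)$ for $t> t_0\ge 0$, and $P(t_0,t_0):=I_N$. A probability vector is a nonnegative vector whose entries sum to $1$. A sequence $\{\pi(t)\}_{t\ge0}$ of probability vectors in $\mathbb R^N$ is a set of absolute probability vectors for $\{P(t)\}_{t\ge0}$ if $\pi(t+1)^\top P(t)=\pi(t)^\top$ for all $t\ge 0$. $\|\cdot\|$ denotes any norm (matrix norms sub-multiplicative); the conditions do not depend on the choice since all norms are equivalent. *)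

(* Defs.v *)
From HB Require Import structures.
From mathcomp Require Export all_boot all_order all_algebra.
From mathcomp Require Export all_classical all_reals all_analysis.

Set Implicit Arguments.
Unset Strict Implicit.
Unset Printing Implicit Defensive.

Export Order.TTheory GRing.Theory Num.Theory.
Export numFieldNormedType.Exports.

Local Open Scope classical_set_scope.
Local Open Scope ring_scope.

Section Matrices.
Context {R : realType} {N : nat}.
Implicit Types (A : 'M[R]_N) (P : nat -> 'M[R]_N).

Definition row_stochastic A : Prop :=
  (forall i j, 0 <= A i j) /\ (forall i, \sum_j A i j = 1).

Definition positive_mx A : Prop := forall i j, 0 < A i j.

(* P(t, t0) = P(t-1) P(t-2) ... P(t0), and the identity when t = t0 *)
Definition backward_prod P (t t0 : nat) : 'M[R]_N :=
  \big[mulmx/1%:M]_(s <- rev (index_iota t0 t)) P s.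

(* The neutral element 1 does not affect the minimum when A is row-stochastic:
   the entries of A are then at most 1, and some of them are positive. *)
Definition min_pos_entry A : R :=
  \big[Num.min/1]_(i < N) \big[Num.min/1]_(j < N | 0 < A i j) A i j.

Definition probability_vector (v : 'cV[R]_N) : Prop :=
  (forall i, 0 <= v i 0) /\ \sum_i v i 0 = 1.

Definition absolute_probability_vectors (pi : nat -> 'cV[R]_N) P : Prop :=
  (forall t, probability_vector (pi t)) /\
  (forall t, (pi t.+1)^T *m P t = (pi t)^T).

Definition stepsize_mx (delta : nat -> 'I_N -> R) (t : nat) : 'M[R]_N :=
  diag_mx (\row_i delta t i).

Definition spread (v : 'I_N -> R) : R :=
  \big[Num.max/0]_(i < N) \big[Num.max/0]_(j < N) `|v i - v j|.

End Matrices.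

(* An arbitrary norm; nonnegativity follows from the three axioms. *)
Definition is_norm {R : realType} {V : lmodType R} (nu : V -> R) : Prop :=
  [/\ forall u v, nu (u + v) <= nu u + nu v,
      forall (a : R) v, nu (a *: v) = `|a| * nu v &
      forall v, nu v = 0 -> v = 0].

Definition submultiplicative {R : realType} {N : nat} (nu : 'M[R]_N -> R) :
    Prop :=
  forall A B, nu (A *m B) <= nu A * nu B.

Section Convex.
Context {R : realType} {d : nat}.
Implicit Types (f : 'rV[R]_d -> R) (z g : 'rV[R]_d).

Definition subdifferential f z : set 'rV[R]_d :=
  [set g : 'rV[R]_d | forall y : 'rV[R]_d,
     f z + \sum_l g 0 l * (y 0 l - z 0 l) <= f y].

Definition norm1 g : R := \sum_l `|g 0 l|.

Definition subgradient_bound f : \bar R :=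
  ereal_sup [set ereal_sup [set (norm1 g)%:E | g in subdifferential f z]
            | z in [set: 'rV[R]_d]].

Definition minimizer f z : Prop := forall y, f z <= f y.

End Convex.

(* Main.v *)
Require Import Defs.
From mathcomp Require Import ring lra.

(* Let [y t] be the mean of the [x t i] with weights [pi t]; since [pi t.+1]
   pulls back to [pi t] along [P t], it moves only by the weighted subgradients.
   Let [D t] be the largest stepsize and [V t] the diameter of the [x t i].

   Over [T] steps [V] contracts by a factor [q < 1] up to a sum of [T] values of
   [D], so, by convexity of the square, [sum D^2 < oo] (a consequence of (A2))
   yields [sum V^2 < oo], hence [V --> 0] and [sum D V < oo].

   Convex functions on R^d with bounded subgradients are Lipschitz, which gives
   the quasi-Fejer inequality
     |y (t+1) - z|^2 + 2 w t (F (y t) - F z) <= |y t - z|^2 + e t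
   where [w t] is one of the weights [pi_i (t+1) delta_i t], and [e t] is
   bounded by multiples of [D^2], [D V] and [spread * |y t - z|].  As
   [sum D^2 < oo], [|y t - z|] grows at most like [sqrt t], so [sum e < oo] by
   (A3).  Also by (A3), [sum w = oo], so [F (y t)] comes arbitrarily close to
   [min F]; a cluster point [p] of the corresponding times is a minimizer, and
   the inequality at [z = p] forces [y --> p]. *)

Set Implicit Arguments.
Unset Strict Implicit.
Unset Printing Implicit Defensive.

Local Open Scope classical_set_scope.
Local Open Scope ring_scope.

(** * Summability through bounded partial sums *)

Section BoundedPartialSums.
Context {R : realType}.
Implicit Types a b e v : nat -> R.

(** For nonnegative terms this is summability; real upper bounds keep the estimates out of the
    extended reals. *)
Definition bounded_psums a := exists C, forall n, \sum_(0 <= t < n) a t <= C.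

Lemma bounded_psums_le a b :
  (forall t, a t <= b t) -> bounded_psums b -> bounded_psums a.
Proof.
move=> ab [C bC]; exists C => n; apply: le_trans (bC n).
by apply: ler_sum => t _.
Qed.

Lemma bounded_psumsD a b :
  bounded_psums a -> bounded_psums b -> bounded_psums (fun t => a t + b t).
Proof.
move=> [C aC] [C' bC']; exists (C + C') => n.
by rewrite big_split lerD.
Qed.

Lemma bounded_psumsZ c a :
  0 <= c -> bounded_psums a -> bounded_psums (fun t => c * a t).
Proof.
by move=> c0 [C aC]; exists (c * C) => n; rewrite -big_distrr ler_wpM2l.
Qed.

Lemma psums_nondecreasing a m n : (forall t, 0 <= a t) -> (m <= n)%N ->
  \sum_(0 <= t < m) a t <= \sum_(0 <= t < n) a t.
Proof.
move=> a0 mn; rewrite (@big_cat_nat _ _ _ m 0 n)//= lerDl.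
by apply: sumr_ge0 => t _.
Qed.

Lemma bounded_psums_shift s a : (forall t, 0 <= a t) ->
  bounded_psums a -> bounded_psums (fun t => a (t + s)%N).
Proof.
move=> a0 [C aC]; exists C => n; apply: le_trans (aC (n + s)%N).
rewrite (@big_cat_nat _ _ _ s 0 (n + s))//= ?leq_addl//.
by rewrite -{3}[s]add0n big_addn addnK lerDr sumr_ge0.
Qed.

(** Induction on [T], using [(S + b)^2 <= 2 (S^2 + b^2)] at each step. *)
Lemma bounded_psums_window T b : (forall t, 0 <= b t) ->
  bounded_psums (fun t => b t ^+ 2) ->
  bounded_psums (fun t => (\sum_(0 <= s < T) b (t + s)%N) ^+ 2).
Proof.
move=> b0 bS; elim: T => [|T IH].
  by exists 0 => n; rewrite big1// => t _; rewrite big_geq// expr0n.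
have bT : bounded_psums (fun t => b (t + T)%N ^+ 2).
  by apply: (@bounded_psums_shift _ (fun t => b t ^+ 2)) => // t; exact: sqr_ge0.
apply: bounded_psums_le (bounded_psumsZ (ler0n _ 2) (bounded_psumsD IH bT)) => t.
rewrite big_nat_recr//=; set S := \sum_(_ <= _ < _) _.
by have := sqr_ge0 (S - b (t + T)%N); lra.
Qed.

(** The first [M] terms of [a], taken in absolute value, go into the constant. *)
Lemma bounded_psums_eventually M c a b : 0 <= c ->
  (forall t, 0 <= b t) -> (forall t, (M <= t)%N -> a t <= c * b t) ->
  bounded_psums b -> bounded_psums a.
Proof.
move=> c0 b0 ab [C bC]; exists (\sum_(0 <= t < M) `|a t| + c * C) => n.
have h t : a t <= (if (t < M)%N then `|a t| else 0) + c * b t.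
  case: ltnP => tM; last by rewrite add0r ab.
  by rewrite (le_trans (ler_norm _))// lerDl mulr_ge0.
apply: le_trans (ler_sum _ (fun t _ => h t)) _.
rewrite big_split -big_distrr lerD//= ?ler_wpM2l//.
set u := (X in \sum_(0 <= i < n) X i).
have u0 t : 0 <= u t by rewrite /u; case: ifP.
have [nM|/ltnW Mn] := leqP n M.
  apply: le_trans (psums_nondecreasing u0 nM) _.
  by rewrite le_eqVlt; apply/orP; left; apply/eqP/eq_big_nat => t /= tM; rewrite /u tM.
rewrite (@big_cat_nat _ _ _ M 0 n)//= [X in _ + X]big_nat_cond [X in _ + X]big1 ?addr0.
  by rewrite le_eqVlt; apply/orP; left; apply/eqP/eq_big_nat => t /= tM; rewrite /u tM.
by move=> t /andP[/andP[Mt _] _]; rewrite /u ltnNge Mt.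
Qed.

Lemma bounded_psums_tail a eps : (forall t, 0 <= a t) -> bounded_psums a ->
  0 < eps ->
  exists M, forall m n, (M <= m)%N -> \sum_(m <= t < n) a t <= eps.
Proof.
move=> a0 [C aC] e0; pose S := range (fun n => \sum_(0 <= t < n) a t).
have hS : has_sup S.
  by split; [exists (\sum_(0 <= t < 0) a t); exists 0%N | exists C => _ [n _ <-]].
have [_ [M _ <-] SM] := sup_adherent e0 hS.
exists M => m n Mm; have [nm|/ltnW mn] := leqP n m; first by rewrite big_geq ?ltW.
have : \sum_(0 <= t < n) a t <= sup S by apply: sup_upper_bound => //; exists n.
have := psums_nondecreasing a0 Mm.
by rewrite (@big_cat_nat _ _ _ m 0 n)//=; lra.
Qed.

Lemma bounded_psums_small a eps : (forall t, 0 <= a t) -> bounded_psums a ->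
  0 < eps -> exists M, forall t, (M <= t)%N -> a t <= eps.
Proof.
move=> a0 aS /(bounded_psums_tail a0 aS)[M hM]; exists M => t Mt.
by have := hM t t.+1 Mt; rewrite big_nat1.
Qed.

Lemma quasi_fejer_le a b e : (forall t, 0 <= b t) ->
  (forall t, a t.+1 + b t <= a t + e t) -> forall m n, (m <= n)%N ->
  a n + \sum_(m <= t < n) b t <= a m + \sum_(m <= t < n) e t.
Proof.
move=> b0 abe m n /subnK <-; elim: (n - m)%N => [|k IH].
  by rewrite add0n !big_geq.
rewrite addSn !big_nat_recr ?leq_addl//=.
by have := abe (k + m)%N; lra.
Qed.

(** With [b t = (1 - q) * u], the bound [q * v t + b t] is a convex combination, and convexity of
    the square gives a linear recursion for [v t ^+ 2]. Summing it bounds [S (n + T)] by [q * S n]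
    plus a constant; as [S n <= S (n + T)] and [q < 1], the term [q * S n] is absorbed. *)
Lemma bounded_psums_contraction T q v b : 0 <= q -> q < 1 ->
  (forall t, 0 <= v t) -> (forall t, v (t + T)%N <= q * v t + b t) ->
  bounded_psums (fun t => b t ^+ 2) -> bounded_psums (fun t => v t ^+ 2).
Proof.
move=> q0 q1 v0 hv [C bC].
pose S n := \sum_(0 <= t < n) v t ^+ 2.
have sq t : v (t + T)%N ^+ 2 <= q * v t ^+ 2 + (1 - q)^-1 * b t ^+ 2.
  have h : v (t + T)%N ^+ 2 <= (q * v t + b t) ^+ 2.
    by rewrite lerXn2r// nnegrE// (le_trans _ (hv t)).
  apply: (le_trans h); set c := (1 - q)^-1.
  have bE : b t = (1 - q) * (c * b t) by rewrite mulrA divff ?mul1r//; lra.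
  have -> : c * b t ^+ 2 = (1 - q) * (c * b t) ^+ 2.
    by rewrite {1}expr2 {2}bE; ring.
  rewrite {1}bE; set u := c * b t.
  rewrite -subr_ge0 [X in 0 <= X](_ : _ = q * (1 - q) * (v t - u) ^+ 2); last by ring.
  by rewrite mulr_ge0 ?sqr_ge0// mulr_ge0//; lra.
have sqn n : S (n + T)%N <= S T + (q * S n + (1 - q)^-1 * C).
  rewrite /S (@big_cat_nat _ _ _ T 0 (n + T))//= ?leq_addl// lerD2l.
  rewrite -{1}[T]add0n big_addn addnK.
  apply: le_trans (ler_sum _ (fun t _ => sq t)) _.
  rewrite big_split -!big_distrr lerD2l ler_wpM2l//= invr_ge0; lra.
exists ((1 - q)^-1 * (S T + (1 - q)^-1 * C)) => n.
have hn : S n <= S (n + T)%N.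
  by apply: psums_nondecreasing (leq_addr _ _) => t; rewrite sqr_ge0.
rewrite ler_pdivlMl; last lra.
by have := sqn n; rewrite -/(S n); lra.
Qed.

(** The weight [r = sqrt t] balances the two sums that arise: at most [C * r], and [t / r = r]. This
    turns square-summable stepsizes into [sqrt t] growth of the iterates. *)
Lemma psums_le_sqrt a C t : (forall t, 0 <= a t) ->
  (forall n, \sum_(0 <= s < n) a s ^+ 2 <= C) ->
  \sum_(0 <= s < t) a s <= (C + 1) * Num.sqrt t%:R.
Proof.
move=> a0 aC; case: t => [|t]; first by rewrite big_geq// sqrtr0 mulr0.
set r := Num.sqrt _; have r0 : 0 < r by rewrite sqrtr_gt0 ltr0n.
have r2 : t.+1%:R = r ^+ 2 by rewrite sqr_sqrtr// ler0n.
(* AM-GM: [a s <= r * a s ^+ 2 + 1 / r] *)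
have h s : a s <= r * a s ^+ 2 + r^-1.
  rewrite -(ler_pM2l r0) mulrDr divff ?gt_eqF//.
  by have := sqr_ge0 (r * a s - 2^-1); have := sqr_ge0 (r * a s); nra.
apply: le_trans (ler_sum _ (fun s _ => h s)) _.
rewrite big_split -big_distrr/= sumr_const_nat subn0 -mulr_natl r2.
rewrite expr2 -mulrA divff ?gt_eqF// mulr1 mulrDl mul1r lerD2r mulrC.
by rewrite ler_pM2r.
Qed.

(** Bridge to the extended-real series in which the hypotheses of the theorem are stated. *)
Lemma nneseries_ltyP a : (forall t, 0 <= a t) ->
  (\sum_(0 <= t <oo) (a t)%:E < +oo)%E <-> bounded_psums a.
Proof.
move=> a0; have a0' t : (0 <= (a t)%:E)%E by rewrite lee_fin.
split=> [lty|[C aC]].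
  exists (fine (\sum_(0 <= t <oo) (a t)%:E)%E) => n.
  rewrite -lee_fin fineK; last by rewrite ge0_fin_numE// nneseries_ge0.
  by rewrite -sumEFin; apply: nneseries_lim_ge => *.
apply: (@le_lt_trans _ _ C%:E); last exact: ltry.
apply: lime_le; first by apply: is_cvg_nneseries => *.
by apply: nearW => n; rewrite sumEFin lee_fin.
Qed.

End BoundedPartialSums.

(** * Inner product, existence of subgradients, Lipschitz bounds *)

Section Subgradients.
Context {R : realType} {d : nat}.
Implicit Types (u v w y z : 'rV[R]_d) (f : 'rV[R]_d -> R).

(** The ambient norm of row vectors is the max norm, dual to [norm1]. The quasi-Fejer inequality
    needs Euclidean distances, which are expressed through this inner product. *)
Definition dot u v : R := \sum_l u 0 l * v 0 l.

Lemma dotC u v : dot u v = dot v u.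
Proof. by apply: eq_bigr => l _; rewrite mulrC. Qed.

Lemma dotDr u v w : dot u (v + w) = dot u v + dot u w.
Proof. by rewrite -big_split; apply: eq_bigr => l _; rewrite mxE mulrDr. Qed.

Lemma dotZr c u v : dot u (c *: v) = c * dot u v.
Proof. by rewrite /dot big_distrr; apply: eq_bigr => l _; rewrite mxE mulrCA. Qed.

Lemma dotDl u v w : dot (u + v) w = dot u w + dot v w.
Proof. by rewrite dotC dotDr !(dotC w). Qed.

Lemma dotZl c u v : dot (c *: u) v = c * dot u v.
Proof. by rewrite dotC dotZr dotC. Qed.

Lemma dotNr u v : dot u (- v) = - dot u v.
Proof. by rewrite -scaleN1r dotZr mulN1r. Qed.

Lemma dotNl u v : dot (- u) v = - dot u v.
Proof. by rewrite dotC dotNr dotC. Qed.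

Lemma dot_suml (I : finType) (F : I -> 'rV[R]_d) v :
  dot (\sum_i F i) v = \sum_i dot (F i) v.
Proof.
rewrite /dot exchange_big; apply: eq_bigr => l _ /=.
by rewrite summxE big_distrl.
Qed.

Lemma norm_coord_le v l : `|v 0 l| <= `|v|.
Proof.
rewrite [X in _ <= X]mx_normrE.
by apply: (@le_bigmax _ _ _ 0 (fun ij => `|v ij.1 ij.2|) (0, l)).
Qed.

Lemma norm_row_le v c : 0 <= c -> (forall l, `|v 0 l| <= c) -> `|v| <= c.
Proof.
move=> c0 vc; rewrite [X in X <= _]mx_normrE.
by apply: bigmax_le => // -[i l] _ /=; rewrite ord1.
Qed.

Lemma norm_dot_le u v : `|dot u v| <= norm1 u * `|v|.
Proof.
apply: le_trans (ler_norm_sum _ _ _) _; rewrite /norm1 big_distrl ler_sum//= => l _.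
by rewrite normrM ler_wpM2l// norm_coord_le.
Qed.

Lemma norm_le_norm1 u : `|u| <= norm1 u.
Proof.
apply: norm_row_le => [|l]; first by apply: sumr_ge0.
by rewrite /norm1 (bigD1 l)//= lerDl sumr_ge0.
Qed.

Lemma dot_self_le u : dot u u <= d%:R * `|u| ^+ 2.
Proof.
apply: (@le_trans _ _ (\sum_(l < d) `|u| ^+ 2)); last first.
  by rewrite sumr_const card_ord mulr_natl.
apply: ler_sum => l _; rewrite -expr2 -real_normK ?num_real//.
by rewrite lerXn2r ?nnegrE// norm_coord_le.
Qed.

Lemma sqr_norm_le_dot u : `|u| ^+ 2 <= dot u u.
Proof.
have u0 : 0 <= dot u u by apply: sumr_ge0 => l _; rewrite -expr2 sqr_ge0.
rewrite -(sqr_sqrtr u0) lerXn2r ?nnegrE ?sqrtr_ge0// norm_row_le ?sqrtr_ge0// => l.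
rewrite -sqrtr_sqr ler_wsqrtr// /dot (bigD1 l)//= -expr2 lerDl.
by apply: sumr_ge0 => k _; rewrite -expr2 sqr_ge0.
Qed.

(** Homogeneous form: with unnormalised weights, convexity can be tested on steps of lengths [s] and
    [t] in opposite directions. *)
Lemma convex_functionP f : convex_function [set: 'rV[R]_d] f ->
  forall (s t : R) (x y : 'rV[R]_d), 0 < s -> 0 < t ->
  (s + t) * f ((s + t)^-1 *: (s *: x + t *: y)) <= s * f x + t * f y.
Proof.
move=> cf s t x y s0 t0; have st0 : 0 < s + t by rewrite addr_gt0.
pose p := s / (s + t).
have p01 : (0 <= p <= 1)%R.
  rewrite /p ler_pdivrMr// mul1r lerDl (ltW t0) andbT.
  by rewrite divr_ge0 ?ltW.
have h : f (p *: x + (1 - p) *: y) <= p * f x + (1 - p) * f y.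
  exact: cf (Itv01 (andP p01).1 (andP p01).2) x y (mem_set I) (mem_set I).
have e : 1 - p = t / (s + t) by rewrite /p; field; rewrite gt_eqF.
rewrite -ler_pdivlMl// scalerDr !scalerA ![(s + t)^-1 * _]mulrC.
move: h; rewrite e => h; apply: (le_trans h).
by rewrite mulrDl !(mulrAC _ (s + t)^-1).
Qed.

(* The Hahn-Banach argument, one coordinate at a time: the [k]-th coordinate
   of the subgradient is the supremum of the lower bounds imposed by [f]. *)
Lemma subgradient_step f z (k : nat) g (hk : (k < d)%N) :
  convex_function [set: 'rV[R]_d] f ->
  (forall v, (forall l : 'I_d, (k <= l)%N -> v 0 l = 0) ->
     dot g v <= f (z + v) - f z) ->
  exists g', forall v, (forall l : 'I_d, (k < l)%N -> v 0 l = 0) ->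
     dot g' v <= f (z + v) - f z.
Proof.
move=> cf gP; pose K := Ordinal hk; pose e := delta_mx 0 K : 'rV[R]_d.
pose h v := f (z + v) - f z.
pose S v := forall l : 'I_d, (k <= l)%N -> v 0 l = 0.
(* Backward slopes along [e] never exceed forward slopes: with weights [s] and [t] the
   [e]-components of the two points cancel, leaving [z + m] with [m] in [S], where [gP] applies. *)
have key v v' s t : S v -> S v' -> 0 < s -> 0 < t ->
    (dot g v' - h (v' - s *: e)) / s <= (h (v + t *: e) - dot g v) / t.
  move=> Sv Sv' s0 t0; have st0 : 0 < s + t by rewrite addr_gt0.
  rewrite ler_pdivlMr// mulrAC ler_pdivrMr//.
  have := convex_functionP cf (z + (v + t *: e)) (z + (v' - s *: e)) s0 t0.
  set m := (s + t)^-1 *: (s *: v + t *: v').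
  have -> : (s + t)^-1 *: (s *: (z + (v + t *: e)) + t *: (z + (v' - s *: e))) = z + m.
    apply/rowP => l; rewrite !mxE; field; by rewrite gt_eqF.
  have Sm : S m by move=> l kl; rewrite !mxE Sv// Sv'// !(mulr0, addr0).
  have := gP _ Sm; rewrite -(ler_pM2l st0).
  have -> : (s + t) * dot g m = s * dot g v + t * dot g v'.
    by rewrite dotZr dotDr !dotZr mulrA divff ?gt_eqF// mul1r.
  by rewrite /h; nra.
pose A := [set c | exists v s, [/\ S v, 0 < s & c = (dot g v - h (v - s *: e)) / s]].
have S0 : S 0 by move=> l _; rewrite mxE.
have hA : has_sup A.
  split; first by exists ((dot g 0 - h (0 - 1 *: e)) / 1); exists 0, 1; split.
  exists ((h (0 + 1 *: e) - dot g 0) / 1) => _ [v [s [Sv s0 ->]]].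
  exact: key.
pose c := sup A.
exists (g + (c - g 0 K) *: e) => v vP.
pose tau := v 0 K; pose v0 := v - tau *: e.
have Sv0 : S v0.
  move=> l; rewrite !mxE /= leq_eqVlt => /orP[/eqP kl|kl].
    have -> : l = K by apply/val_inj.
    by rewrite eqxx mulr1 /tau subrr.
  by rewrite vP// (_ : l == K = false) ?mulr0 ?subr0// -val_eqE /= gtn_eqF.
have vE : v = v0 + tau *: e by rewrite subrK.
have dote u : dot e u = u 0 K.
  rewrite /dot (bigD1 K)//= big1 ?addr0 ?mxE ?eqxx ?mul1r// => l lK.
  by rewrite mxE /= (negbTE lK) mul0r.
have ge : dot g e = g 0 K by rewrite dotC dote.
have -> : dot (g + (c - g 0 K) *: e) v = dot g v0 + tau * c.
  by rewrite dotDl dotZl dote -/tau {1}vE dotDr dotZr ge; ring.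
rewrite -/(h v) vE.
(* For [tau < 0] use that [c] is an upper bound of [A]; for [tau > 0], that it is the least one,
   since by [key] every forward slope bounds [A]. *)
have [tau0|tau0|->] := ltrgtP tau 0; last by rewrite scale0r mul0r !addr0 gP.
- have : (dot g v0 - h (v0 + tau *: e)) / - tau <= c.
    apply: sup_upper_bound => //; exists v0, (- tau); split => //; first lra.
    by rewrite scaleNr opprK.
  by rewrite ler_pdivrMr; lra.
- have : c <= (h (v0 + tau *: e) - dot g v0) / tau.
    by apply: ge_sup hA.1 _ => _ [v1 [s [Sv1 s0 ->]]]; exact: key.
  by rewrite ler_pdivlMr; lra.
Qed.

(** Induction on the number of coordinates in which the displacement may be nonzero; at [d] no
    restriction is left. *)
Lemma subdifferential_neq0 f z : convex_function [set: 'rV[R]_d] f ->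
  subdifferential f z !=set0.
Proof.
move=> cf.
have {cf}: forall k, (k <= d)%N -> exists g, forall v,
    (forall l : 'I_d, (k <= l)%N -> v 0 l = 0) -> dot g v <= f (z + v) - f z.
  elim=> [_|k IH kd].
    exists 0 => v v0; have -> : v = 0 by apply/rowP => l; rewrite mxE v0.
    by rewrite addr0 subrr -(scale0r 0) dotZr mul0r.
  by have [g gP] := IH (ltnW kd); exact: subgradient_step cf gP.
move=> /(_ d (leqnn _))[g gP]; exists g => y.
have := gP (y - z); rewrite (addrC z) subrK lerBrDl.
have -> : dot g (y - z) = \sum_l g 0 l * (y 0 l - z 0 l).
  by apply: eq_bigr => l _; rewrite !mxE.
by apply=> l; rewrite leqNgt ltn_ord.
Qed.

Lemma subdifferentialP f z g : subdifferential f z g ->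
  forall y, f z + dot g (y - z) <= f y.
Proof.
move=> gz y; apply: le_trans (gz y); rewrite lerD2l le_eqVlt; apply/orP; left.
by apply/eqP/eq_bigr => l _; rewrite !mxE.
Qed.

Lemma subgradient_boundP f : (subgradient_bound f < +oo)%E ->
  exists2 L, 0 <= L & forall z g, subdifferential f z g -> norm1 g <= L.
Proof.
(* The maximum with 0 makes the bound nonnegative without asking that a subgradient exist. *)
move=> fL; exists (Num.max 0 (fine (subgradient_bound f))) => [|z g gz].
  by rewrite le_max lexx.
have gL : ((norm1 g)%:E <= subgradient_bound f)%E.
  apply: (@le_trans _ _ (ereal_sup [set (norm1 g)%:E | g in subdifferential f z])).
    by apply: ereal_sup_ubound; exists g.
  by apply: ereal_sup_ubound; exists z.
rewrite le_max; apply/orP; right; rewrite -lee_fin fineK// fin_numElt fL andbT.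
exact: lt_le_trans (ltNyr _) gL.
Qed.

(** The subgradient is taken at [y] and tested at [z], so that it bounds [f y] from above. *)
Lemma convex_lipschitz f L : convex_function [set: 'rV[R]_d] f ->
  (forall z g, subdifferential f z g -> norm1 g <= L) ->
  forall y z, f y <= f z + L * `|y - z|.
Proof.
move=> cf fL y z; have [g gy] := subdifferential_neq0 y cf.
have := subdifferentialP gy z; have := norm_dot_le g (z - y).
rewrite distrC => /ler_normlP[+ _].
by have := ler_wpM2r (normr_ge0 (z - y)) (fL _ _ gy); rewrite !(distrC z); lra.
Qed.

End Subgradients.

Lemma le_bigmax2 {R : realType} {N : nat} (F : 'I_N -> 'I_N -> R) i j :
  F i j <= \big[Num.max/0]_(i < N) \big[Num.max/0]_(j < N) F i j.
Proof.
apply: (le_trans (le_bigmax 0 (F i) j)).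
exact: (le_bigmax 0 (fun i => \big[Num.max/0]_(j < N) F i j) i).
Qed.

(** * Stochastic matrices and lower bounds on positive entries of products *)

Section StochasticMatrices.
Context {R : realType} {N : nat}.
Implicit Types (A B : 'M[R]_N) (P : nat -> 'M[R]_N).

Lemma row_stochastic1 : row_stochastic (1%:M : 'M[R]_N).
Proof.
split=> [i j|i]; first by rewrite mxE ler0n.
rewrite (bigD1 i)//= big1 ?addr0 ?mxE ?eqxx// => j ji.
by rewrite mxE eq_sym (negbTE ji).
Qed.

Lemma row_stochasticM A B :
  row_stochastic A -> row_stochastic B -> row_stochastic (A *m B).
Proof.
move=> [A0 A1] [B0 B1]; split=> [i j|i].
  by rewrite mxE sumr_ge0// => k _; rewrite mulr_ge0.
under eq_bigr do rewrite mxE.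
rewrite exchange_big/= -[RHS](A1 i); apply: eq_bigr => k _.
by rewrite -big_distrr/= B1 mulr1.
Qed.

Lemma backward_prodS P t t0 : (t0 <= t)%N ->
  backward_prod P t.+1 t0 = P t *m backward_prod P t t0.
Proof.
move=> t0t; rewrite /backward_prod /index_iota subSn// -addn1 iotaD rev_cat.
by rewrite subnKC//= big_cons.
Qed.

Lemma backward_prod0 P t : backward_prod P t t = 1%:M.
Proof. by rewrite /backward_prod /index_iota subnn big_nil. Qed.

Lemma row_stochastic_backward_prod P t n :
  (forall s, row_stochastic (P s)) -> row_stochastic (backward_prod P (t + n) t).
Proof.
move=> Ps; elim: n => [|n IH].
  by rewrite addn0 backward_prod0; exact: row_stochastic1.
by rewrite addnS backward_prodS ?leq_addr//; exact: row_stochasticM.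
Qed.

Lemma min_pos_entry_le A i j : 0 < A i j -> min_pos_entry A <= A i j.
Proof.
move=> Aij; apply: (bigmin_inf i) => //.
exact: bigmin_le_cond.
Qed.

Lemma min_pos_entry_ge0 A : 0 <= min_pos_entry A.
Proof. by apply: le_bigmin => // i _; apply: le_bigmin => // j /ltW. Qed.

(** A positive entry of the product contains a positive term [A i k * B k j], which is at least
    [p * q]; the other terms are nonnegative. *)
Lemma pos_entry_mulmx_ge (p q : R) A B i j : 0 <= p -> 0 <= q ->
  (forall i j, 0 <= A i j) -> (forall i j, 0 <= B i j) ->
  (forall i j, 0 < A i j -> p <= A i j) ->
  (forall i j, 0 < B i j -> q <= B i j) ->
  0 < (A *m B) i j -> p * q <= (A *m B) i j.
Proof.
move=> p0 q0 A0 B0 Ap Bq; rewrite mxE => /lt0r_neq0/eqP/psumr_neq0P.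
case=> [k _|k /andP[_ ABk]]; first exact: mulr_ge0.
have [Ak Bk] : 0 < A i k /\ 0 < B k j.
  by split; rewrite lt_def ?A0 ?B0 andbT; apply: contraTneq ABk => ->;
    rewrite ?mul0r ?mulr0 ltxx.
rewrite (bigD1 k)//= (le_trans (ler_pM p0 q0 (Ap _ _ Ak) (Bq _ _ Bk)))// lerDl.
by apply: sumr_ge0 => l _; exact: mulr_ge0.
Qed.

(** The bound is uniform in [t]: positive products over [T] steps have all their entries at least
    [p ^+ T]. *)
Lemma pos_entry_backward_prod_ge P (p : R) t n : 0 <= p ->
  (forall s, row_stochastic (P s)) ->
  (forall s i j, 0 < P s i j -> p <= P s i j) ->
  forall i j, 0 < backward_prod P (t + n) t i j ->
    p ^+ n <= backward_prod P (t + n) t i j.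
Proof.
move=> p0 Ps Pp; elim: n => [|n IH] i j.
  by rewrite addn0 backward_prod0 mxE expr0; case: eqP; rewrite ?ltxx.
rewrite addnS backward_prodS ?leq_addr// exprS.
have [Q0 _] := row_stochastic_backward_prod t n Ps.
by apply: pos_entry_mulmx_ge; rewrite ?exprn_ge0//; [exact: (Ps _).1|exact: Pp].
Qed.

End StochasticMatrices.

(** * Weighted averages and the diameter of a family of points *)

Section Averages.
Context {R : realType} {N d : nat}.
Implicit Types (v : 'I_N -> 'rV[R]_d) (a b : 'I_N -> R).

Definition diam v : R := \big[Num.max/0]_(i < N) \big[Num.max/0]_(j < N) `|v i - v j|.

Lemma diam_ge0 v : 0 <= diam v.
Proof. exact: bigmax_ge_id. Qed.

Lemma le_diam v i j : `|v i - v j| <= diam v.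
Proof. exact: (le_bigmax2 (fun i j => `|v i - v j|)). Qed.

Lemma diam_le v c : 0 <= c -> (forall i j, `|v i - v j| <= c) -> diam v <= c.
Proof. by move=> c0 vc; do 2!apply: bigmax_le => // ? _. Qed.

Lemma norm_weighted_sum_le a v c : (forall i, 0 <= a i) ->
  (forall i, `|v i| <= c) -> `|\sum_i a i *: v i| <= (\sum_i a i) * c.
Proof.
move=> a0 vc; apply: le_trans (ler_norm_sum _ _ _) _.
by rewrite big_distrl ler_sum//= => i _; rewrite normrZ ger0_norm// ler_wpM2l.
Qed.

Lemma dist_average_le a v u c : (forall i, 0 <= a i) -> \sum_i a i = 1 ->
  (forall i, `|u - v i| <= c) -> `|u - \sum_i a i *: v i| <= c.
Proof.
move=> a0 a1 vc.
have -> : u - \sum_i a i *: v i = \sum_i a i *: (u - v i).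
  under [RHS]eq_bigr do rewrite scalerBr.
  by rewrite sumrB -scaler_suml a1 scale1r.
by rewrite -[c]mul1r -a1; exact: norm_weighted_sum_le.
Qed.

(** Multiplied by [m], the difference becomes the double sum of [a i * b j] times [v i - v j]. As
    [m] is cancelled at the end, [m = 0] is a separate case. *)
Lemma dist_weighted_sums_le a b v m c :
  (forall i, 0 <= a i) -> (forall i, 0 <= b i) ->
  \sum_i a i = m -> \sum_i b i = m -> (forall i j, `|v i - v j| <= c) ->
  `|\sum_i a i *: v i - \sum_i b i *: v i| <= m * c.
Proof.
move=> a0 b0 am bm vc; have m0 : 0 <= m by rewrite -am sumr_ge0.
have [m_eq0|m_neq0] := eqVneq m 0.
  rewrite m_eq0 in am bm *.
  have az i : a i = 0 by apply: (psumr_eq0P _ am).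
  have bz i : b i = 0 by apply: (psumr_eq0P _ bm).
  by rewrite !big1 ?subrr ?normr0 ?mul0r// => i _; rewrite ?az ?bz scale0r.
have m_gt0 : 0 < m by rewrite lt_def m_neq0.
have e : m *: (\sum_i a i *: v i - \sum_i b i *: v i) =
    \sum_i a i *: (\sum_j b j *: (v i - v j)).
  under [RHS]eq_bigr => i _.
    under eq_bigr do rewrite scalerBr.
    rewrite sumrB -scaler_suml bm scalerBr scalerA mulrC -scalerA.
    over.
  by rewrite sumrB -scaler_sumr -scaler_suml am scalerBr.
rewrite -(ler_pM2l m_gt0) -{1}(gtr0_norm m_gt0) -normrZ e -{1}am.
apply: norm_weighted_sum_le => // i; rewrite -bm.
exact: norm_weighted_sum_le.
Qed.

(** Doeblin's argument: every row puts mass at least [eta] on one common point, whose contribution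
    cancels in the difference; the remaining weights have mass [1 - eta]. *)
Lemma stochastic_contraction (A : 'M[R]_N) eta v : row_stochastic A ->
  (forall i j, eta <= A i j) ->
  forall i j, `|\sum_k A i k *: v k - \sum_k A j k *: v k| <= (1 - eta) * diam v.
Proof.
move=> [A0 A1] Aeta i j.
(* The common column is arbitrary; the row index [i] is reused for it. *)
pose a k l := A k l - (if l == i then eta else 0).
have a0 k l : 0 <= a k l by rewrite /a; case: ifP => _; rewrite ?subr0// subr_ge0.
have a1 k : \sum_l a k l = 1 - eta.
  by rewrite sumrB A1 -big_mkcond big_pred1_eq.
have aE k : \sum_l A k l *: v l = \sum_l a k l *: v l + eta *: v i.
  have -> : eta *: v i = \sum_l (if l == i then eta else 0) *: v l.
    rewrite (bigD1 i)//= eqxx big1 ?addr0// => l /negbTE ->.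
    by rewrite scale0r.
  by rewrite -big_split; apply: eq_bigr => l _ /=; rewrite -scalerDl subrK.
rewrite !aE opprD addrACA subrr addr0.
by apply: dist_weighted_sums_le => //; exact: le_diam.
Qed.

End Averages.

(** * Perturbed consensus iterations *)

Section PerturbedConsensus.
Context {R : realType} {N d : nat}.
Variables (P : nat -> 'M[R]_N) (x u : nat -> 'I_N -> 'rV[R]_d) (b : nat -> R).
Hypothesis P_stoch : forall t, row_stochastic (P t).
Hypothesis x_step : forall t i, x t.+1 i = \sum_j P t i j *: x t j - u t i.
Hypothesis u_le : forall t i, `|u t i| <= b t.

(** One more step averages the previous errors with a stochastic row, which preserves their common
    bound, and adds one perturbation. *)
Lemma consensus_dist_le t n i :
  `|x (t + n)%N i - \sum_j backward_prod P (t + n) t i j *: x t j| <=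
  \sum_(0 <= s < n) b (t + s)%N.
Proof.
elim: n i => [|n IH] i.
  rewrite addn0 backward_prod0 big_geq// (bigD1 i)//= big1 => [|j /negbTE ji].
    by rewrite mxE eqxx scale1r addr0 subrr normr0.
  by rewrite mxE eq_sym ji scale0r.
rewrite addnS backward_prodS ?leq_addr// x_step big_nat_recr//=.
set Q := backward_prod P (t + n) t.
have -> : \sum_j (P (t + n)%N *m Q) i j *: x t j =
    \sum_k P (t + n)%N i k *: (\sum_j Q k j *: x t j).
  under eq_bigr do rewrite mxE scaler_suml.
  rewrite exchange_big/=; apply: eq_bigr => k _; rewrite scaler_sumr.
  by apply: eq_bigr => j _; rewrite scalerA.
rewrite addrAC; apply: le_trans (ler_normB _ _) _.
apply: lerD (u_le _ _); rewrite -[leRHS]mul1r -((P_stoch (t + n)%N).2 i).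
have -> : \sum_j P (t + n)%N i j *: x (t + n)%N j -
      \sum_k P (t + n)%N i k *: (\sum_j Q k j *: x t j) =
    \sum_k P (t + n)%N i k *: (x (t + n)%N k - \sum_j Q k j *: x t j).
  by rewrite -sumrB; apply: eq_bigr => k _; rewrite scalerBr.
by apply: norm_weighted_sum_le IH; exact: (P_stoch _).1.
Qed.

Lemma consensus_norm_le t i :
  `|x t i| <= \big[Num.max/0]_j `|x 0%N j| + \sum_(0 <= s < t) b s.
Proof.
have := consensus_dist_le 0 t i; rewrite !add0n => h.
set Q := backward_prod P t 0 in h *.
have Qs : row_stochastic Q := row_stochastic_backward_prod 0 t P_stoch.
have h' : `|\sum_j Q i j *: x 0%N j| <= \big[Num.max/0]_j `|x 0%N j|.
  rewrite -[leRHS]mul1r -(Qs.2 i); apply: norm_weighted_sum_le; first exact: Qs.1.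
  exact: le_bigmax.
by rewrite -(subrK (\sum_j Q i j *: x 0%N j) (x t i)) addrC (le_trans (ler_normD _ _))// lerD.
Qed.

Lemma diam_sqr_bounded_psums T p : 0 < p ->
  (forall t i j, 0 < P t i j -> p <= P t i j) ->
  (forall t, positive_mx (backward_prod P (t + T) t)) ->
  (forall t, 0 <= b t) -> bounded_psums (fun t => b t ^+ 2) ->
  bounded_psums (fun t => diam (x t) ^+ 2).
Proof.
move=> p0 Pp PT b0 bS.
case: (posnP N) => [N0|N_gt0].
  exists 0 => n; rewrite big1// => t _; apply/eqP; rewrite sqrf_eq0 eq_le diam_ge0 andbT.
  by apply: diam_le => // i; have := ltn_ord i; rewrite [X in (_ < X)%N]N0.
pose i0 := Ordinal N_gt0; pose eta := p ^+ T.
have Q_ge t i j : eta <= backward_prod P (t + T) t i j.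
  exact: (pos_entry_backward_prod_ge (ltW p0) P_stoch Pp (PT t i j)).
have Q_st t := row_stochastic_backward_prod t T P_stoch.
have eta0 : 0 < eta by rewrite exprn_gt0.
have eta1 : eta <= 1.
  rewrite (le_trans (Q_ge 0%N i0 i0))// -((Q_st 0%N).2 i0) (bigD1 i0)//= lerDl.
  by rewrite sumr_ge0// => j _; exact: (Q_st 0%N).1.
pose e t := \sum_(0 <= s < T) b (t + s)%N.
(* The factor 2 comes from replacing both [x (t + T) i] and [x (t + T) j] by averages of the
   [x t k], each at cost [e t]. *)
apply: (@bounded_psums_contraction _ T (1 - eta) _ (fun t => 2 * e t)).
- by rewrite subr_ge0.
- by rewrite gtrBl.
- by move=> t; exact: diam_ge0.
- move=> t; apply: diam_le => [|i j].
    rewrite addr_ge0 ?mulr_ge0 ?diam_ge0 ?subr_ge0// /e sumr_ge0//.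
  set X := fun i => \sum_k backward_prod P (t + T) t i k *: x t k.
  have -> : x (t + T)%N i - x (t + T)%N j =
     (X i - X j) + ((x (t + T)%N i - X i) - (x (t + T)%N j - X j)).
    by move: (X i) (X j) => Xi Xj; apply/rowP => l; rewrite !mxE; ring.
  apply: le_trans (ler_normD _ _) _; apply: lerD.
    exact: stochastic_contraction.
  apply: le_trans (ler_normB _ _) _; rewrite mulrDl mul1r.
  by apply: lerD; exact: consensus_dist_le.
- apply: bounded_psums_le (bounded_psumsZ (ler0n _ 4) (bounded_psums_window T b0 bS)) => t.
  by rewrite exprMn -natrX.
Qed.

End PerturbedConsensus.

(** * Arbitrary norms, and compactness of balls *)

Section Norms.
Context {R : realType}.

Lemma is_norm_ge0 {V : lmodType R} (nu : V -> R) : is_norm nu ->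
  forall v, 0 <= nu v.
Proof.
move=> [nuD nuZ _] v; have nu0 : nu 0 = 0 by rewrite -(scale0r 0) nuZ normr0 mul0r.
have := nuD v (- v); rewrite subrr nu0 -scaleN1r nuZ normrN1 mul1r; lra.
Qed.

(* Compress the diagonal matrix by the matrix unit [E_ii]. *)
Lemma stepsize_le_norm {N : nat} (nu : 'M[R]_N -> R) (delta : nat -> 'I_N -> R) t i :
  is_norm nu -> submultiplicative nu -> `|delta t i| <= nu (stepsize_mx delta t).
Proof.
move=> nuN nuM; have [_ nuZ nu_inj] := nuN.
have E_gt0 : 0 < nu (delta_mx i i).
  rewrite lt_def is_norm_ge0// andbT; apply/eqP => /nu_inj/matrixP/(_ i i).
  by rewrite !mxE !eqxx => /eqP; rewrite oner_eq0.
have := nuM (delta_mx i i) (stepsize_mx delta t).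
have -> : delta_mx i i *m stepsize_mx delta t = delta t i *: delta_mx i i.
  apply/matrixP => k l; rewrite mul_mx_diag !mxE mulrC.
  by case: (l =P i) => [->//|_]; rewrite andbF !mulr0.
by rewrite nuZ mulrC ler_pM2l.
Qed.

(** Expansion along the standard basis. This one-sided comparison is enough to pass from divergence
    in [nu] to divergence of the largest coordinates. *)
Lemma is_norm_le_max {N : nat} (nu : 'cV[R]_N -> R) : is_norm nu ->
  exists2 c, 0 <= c & forall (v : 'cV[R]_N) m, (forall i, `|v i 0| <= m) -> nu v <= c * m.
Proof.
move=> nuN; have [nuD nuZ _] := nuN.
exists (\sum_i nu (delta_mx i 0)) => [|v m vm].
  by apply: sumr_ge0 => i _; exact: is_norm_ge0.
have nu_sum (F : 'I_N -> 'cV[R]_N) : nu (\sum_i F i) <= \sum_i nu (F i).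
  elim/big_ind2: _ => // [|u a w b ua wb]; last by rewrite (le_trans (nuD _ _))// lerD.
  by rewrite -(scale0r 0) nuZ normr0 mul0r.
have -> : v = \sum_i v i 0 *: delta_mx i 0.
  by rewrite {1}(matrix_sum_delta v); apply: eq_bigr => i _; rewrite big_ord1.
apply: le_trans (nu_sum _) _; rewrite big_distrl ler_sum//= => i _.
by rewrite nuZ mulrC ler_wpM2l// is_norm_ge0.
Qed.

Lemma bounded_seq_cluster {d : nat} (u : nat -> 'rV[R]_d) K :
  (forall k, `|u k| <= K) ->
  exists p, forall eps M, 0 < eps -> exists2 k, (M <= k)%N & `|u k - p| <= eps.
Proof.
move=> uK.
have cK : compact [set v : 'rV[R]_d | `|v| <= K].
  apply: bounded_closed_compact.
    by exists K; split=> [|M KM v vK]; rewrite ?num_real//= (le_trans vK)// ltW.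
  have -> : [set v : 'rV[R]_d | `|v| <= K] = Num.norm @^-1` [set r : R | r <= K] by [].
  by apply: closed_comp (@closed_le _ K) => v _; exact: norm_continuous.
have uS : (u @ \oo) [set v : 'rV[R]_d | `|v| <= K] by exists 0%N => // k _; exact: uK.
have [p [_ pu]] := cK _ _ uS.
exists p => eps M e0.
have uM : (u @ \oo) (u @` [set k | (M <= k)%N]).
  by exists M => // k Mk; exists k.
have [_ [[k Mk <-] pk]] := pu _ _ uM (nbhsx_ballx p eps e0).
by exists k => //; move: pk; rewrite -ball_normE/= distrC => /ltW.
Qed.

End Norms.

(** * Convergence of the subgradient method *)

Section SubgradientMethod.
Context {R : realType} {N d : nat}.
Variables (f : 'I_N -> 'rV[R]_d -> R) (L : R).
Variables (P : nat -> 'M[R]_N) (delta : nat -> 'I_N -> R).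
Variables (x g : nat -> 'I_N -> 'rV[R]_d) (pi : nat -> 'cV[R]_N).
Hypothesis f_convex : forall i, convex_function [set: 'rV[R]_d] (f i).
Hypothesis L_ge0 : 0 <= L.
Hypothesis f_L : forall i z h, subdifferential (f i) z h -> norm1 h <= L.
Hypothesis P_stoch : forall t, row_stochastic (P t).
Hypothesis x_step : forall t i,
  x t.+1 i = \sum_(j < N) P t i j *: x t j - delta t i *: g t i.
Hypothesis g_sub : forall t i, subdifferential (f i) (x t i) (g t i).
Hypothesis delta_ge0 : forall i t, 0 <= delta t i.
Hypothesis pi_abs : absolute_probability_vectors pi P.

Let F y := \sum_(i < N) f i y.
Let D t := \big[Num.max/0]_(i < N) delta t i.
Let y t := \sum_i pi t i 0 *: x t i.
Let w t i := pi t.+1 i 0 * delta t i.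

Let D_ge0 t : 0 <= D t. Proof. exact: bigmax_ge_id. Qed.

Let delta_le t i : delta t i <= D t. Proof. exact: le_bigmax. Qed.

Let pi_ge0 t i : 0 <= pi t i 0. Proof. exact: (pi_abs.1 t).1. Qed.

Let pi_sum t : \sum_i pi t i 0 = 1. Proof. exact: (pi_abs.1 t).2. Qed.

Let w_ge0 t i : 0 <= w t i. Proof. by rewrite mulr_ge0. Qed.

Let w_le t i : w t i <= D t.
Proof.
rewrite -[D t]mul1r; apply: ler_pM => //; rewrite -(pi_sum t.+1) (bigD1 i)//= lerDl.
exact: sumr_ge0.
Qed.

Let g_le t i : `|g t i| <= L.
Proof. exact: le_trans (norm_le_norm1 _) (f_L (g_sub t i)). Qed.

Let f_lip i u v : f i u <= f i v + L * `|u - v|.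
Proof. exact: convex_lipschitz (f_convex i) (@f_L i) u v. Qed.

Let sum_constN (c : R) : \sum_(i < N) c = N%:R * c.
Proof. by rewrite sumr_const card_ord mulr_natl. Qed.

Let F_lip u v : F u <= F v + N%:R * (L * `|u - v|).
Proof.
by rewrite /F -sum_constN -big_split; apply: ler_sum => i _; exact: f_lip.
Qed.

Lemma weighted_mean_step t : y t.+1 = y t - \sum_i w t i *: g t i.
Proof.
rewrite /y; under eq_bigr do rewrite x_step scalerBr scalerA.
rewrite sumrB; congr (_ - _).
under eq_bigr do rewrite scaler_sumr.
rewrite exchange_big; apply: eq_bigr => j _ /=.
under eq_bigr do rewrite scalerA.
rewrite -scaler_suml; congr (_ *: _).
have /rowP/(_ j) := pi_abs.2 t; rewrite !mxE => <-.
by apply: eq_bigr => i _; rewrite mxE.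
Qed.

Lemma dist_weighted_mean_le t i : `|x t i - y t| <= diam (x t).
Proof. by apply: dist_average_le => // j; exact: le_diam. Qed.

(** The three terms pay for the squared subgradient step ([d] compares Euclidean and max norms), for
    replacing every weight [w t i] by [w t k], and for passing from [x t i] to [y t]. *)
Definition descent_error z t :=
  d%:R * (N%:R * D t * L) ^+ 2 +
  2 * (N%:R * (L * spread (w t) * `|y t - z| + 2 * (D t * L * diam (x t)))).

Lemma weighted_mean_descent k z t :
  dot (y t.+1 - z) (y t.+1 - z) + 2 * (w t k * (F (y t) - F z)) <=
  dot (y t - z) (y t - z) + descent_error z t.
Proof.
pose r := \sum_i w t i *: g t i.
have rr : dot r r <= d%:R * (N%:R * D t * L) ^+ 2.
  apply: (le_trans (dot_self_le r)); rewrite ler_wpM2l// lerXn2r ?nnegrE//.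
    by rewrite !mulr_ge0.
  apply: (@le_trans _ _ ((\sum_i w t i) * L)); first exact: norm_weighted_sum_le.
  by rewrite ler_wpM2r// -sum_constN ler_sum.
have ry : w t k * (F (y t) - F z) -
    N%:R * (L * spread (w t) * `|y t - z| + 2 * (D t * L * diam (x t))) <=
    dot r (y t - z).
  rewrite dot_suml -sumrB big_distrr/=.
  rewrite -sum_constN -sumrB ler_sum// => i _; rewrite dotZl.
  have sub := subdifferentialP (g_sub t i) z.
  have near : `|dot (g t i) (y t - x t i)| <= L * diam (x t).
    apply: le_trans (norm_dot_le _ _) _; apply: ler_pM => //.
    - by apply: sumr_ge0.
    - exact: f_L (g_sub t i).
    - by rewrite distrC dist_weighted_mean_le.
  have fx : f i (y t) <= f i (x t i) + L * diam (x t).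
    apply: (le_trans (f_lip i (y t) (x t i))); rewrite lerD2l ler_wpM2l//.
    by rewrite distrC dist_weighted_mean_le.
  have yz : `|f i (y t) - f i z| <= L * `|y t - z|.
    have := f_lip i (y t) z; have := f_lip i z (y t); rewrite (distrC z).
    by rewrite ler_norml; lra.
  (* [L * diam (x t)] is paid twice: for moving the base point in the linear term and for moving the
     value of [f i]. *)
  have lower : f i (y t) - f i z - 2 * (L * diam (x t)) <= dot (g t i) (y t - z).
    have -> : y t - z = (y t - x t i) - (z - x t i) by rewrite opprB addrA subrK.
    by rewrite dotDr dotNr; move: near => /ler_normlP[]; lra.
  have wi := ler_wpM2l (w_ge0 t i) lower.
  (* For a single [i] the sign of [f i (y t) - f i z] is unknown, so the exchange of weights is
     controlled by the Lipschitz bound [yz]. *)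
  have wki : - (spread (w t) * (L * `|y t - z|)) <=
      (w t i - w t k) * (f i (y t) - f i z).
    suff : `|(w t i - w t k) * (f i (y t) - f i z)| <=
        spread (w t) * (L * `|y t - z|) by move=> /ler_normlP[]; lra.
    rewrite normrM ler_pM//.
    exact: (le_bigmax2 (fun i j => `|w t i - w t j|)).
  have wD : w t i * (L * diam (x t)) <= D t * (L * diam (x t)).
    by rewrite ler_wpM2r// mulr_ge0// diam_ge0.
  by lra.
rewrite weighted_mean_step -/r /descent_error.
rewrite (_ : y t - r - z = (y t - z) - r); last by rewrite addrAC.
move: (y t - z) ry => v ry; rewrite dotDl !dotDr !dotNl !dotNr (dotC _ r).
lra.
Qed.

Hypothesis D_sum : bounded_psums (fun t => D t ^+ 2).
Hypothesis diam_sum : bounded_psums (fun t => diam (x t) ^+ 2).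
Hypothesis spread_sum :
  bounded_psums (fun t => Num.sqrt t%:R * spread (w t)).

Let spread_ge0 t : 0 <= spread (w t). Proof. exact: bigmax_ge_id. Qed.

(** A crude a priori bound, independent of the quasi-Fejer inequality; it lets the factor [sqrt t]
    in [spread_sum] absorb [|y t - z|]. *)
Lemma weighted_mean_growth z :
  exists2 B, 0 <= B & forall t, `|y t - z| <= B * (1 + Num.sqrt t%:R).
Proof.
have [C DC] := D_sum.
pose X0 := \big[Num.max/0]_j `|x 0%N j|.
have X0_ge0 : 0 <= X0 by exact: bigmax_ge_id.
have C_ge0 : 0 <= C by apply: le_trans (DC 0%N); rewrite big_geq.
exists (X0 + `|z| + L * (C + 1)) => [|t].
  by rewrite !addr_ge0 ?mulr_ge0 ?addr_ge0.
have u_le s i : `|delta s i *: g s i| <= L * D s.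
  by rewrite normrZ ger0_norm// mulrC ler_pM.
have xt i : `|x t i| <= X0 + L * ((C + 1) * Num.sqrt t%:R).
  apply: le_trans (consensus_norm_le P_stoch x_step u_le t i) _.
  by rewrite lerD2l -big_distrr ler_wpM2l//= psums_le_sqrt.
have yt : `|y t| <= X0 + L * ((C + 1) * Num.sqrt t%:R).
  by have := norm_weighted_sum_le (pi_ge0 t) xt; rewrite pi_sum mul1r.
apply: le_trans (ler_normB _ _) _.
have s0 := sqrtr_ge0 (t%:R : R); set r := Num.sqrt _ in yt s0 *.
have h1 : 0 <= (X0 + `|z|) * r by rewrite mulr_ge0 ?addr_ge0.
have h2 : 0 <= L * (C + 1) by rewrite mulr_ge0 ?addr_ge0.
by lra.
Qed.

Lemma descent_error_sum z : bounded_psums (descent_error z).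
Proof.
have [B B0 yB] := weighted_mean_growth z.
have S1 : bounded_psums (fun t => spread (w t) * `|y t - z|).
  (* From [t = 1] on, [1 <= sqrt t], hence [B * (1 + sqrt t) <= 2 * B * sqrt t]. *)
  apply: (bounded_psums_eventually (M := 1) (c := 2 * B)) spread_sum.
  - by rewrite mulr_ge0.
  - by move=> t; rewrite mulr_ge0 ?sqrtr_ge0.
  move=> t t1; have r1 : 1 <= Num.sqrt (t%:R : R).
    by rewrite -[X in X <= _]sqrtr1 ler_wsqrtr// ler1n.
  rewrite mulrC mulrA ler_wpM2r// (le_trans (yB t))//.
  by have := ler_wpM2l B0 r1; lra.
have S2 : bounded_psums (fun t => D t * diam (x t)).
  apply: bounded_psums_le (bounded_psumsD D_sum diam_sum) => t.
  have := sqr_ge0 (D t - diam (x t)); have := sqr_ge0 (D t); have := sqr_ge0 (diam (x t)).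
  lra.
have c1 : 0 <= d%:R * (N%:R * L) ^+ 2 by rewrite mulr_ge0// sqr_ge0.
have c2 : 0 <= 2 * N%:R * L by rewrite !mulr_ge0.
have c3 : 0 <= 4 * N%:R * L by rewrite !mulr_ge0.
apply: bounded_psums_le (bounded_psumsD (bounded_psumsZ c1 D_sum)
  (bounded_psumsD (bounded_psumsZ c2 S1) (bounded_psumsZ c3 S2))) => t.
rewrite le_eqVlt; apply/orP; left; apply/eqP; rewrite /descent_error; ring.
Qed.

Let descent_error_ge0 z t : 0 <= descent_error z t.
Proof.
by do ?[done | exact: sqr_ge0 | exact: diam_ge0 | apply: addr_ge0 | apply: mulr_ge0].
Qed.

Variable k : 'I_N.
Hypothesis w_div : ~ bounded_psums (fun t => w t k).

Lemma weighted_mean_fejer z : minimizer F z -> forall m n, (m <= n)%N ->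
  dot (y n - z) (y n - z) +
    \sum_(m <= t < n) 2 * (w t k * (F (y t) - F z)) <=
  dot (y m - z) (y m - z) + \sum_(m <= t < n) descent_error z t.
Proof.
move=> zmin; apply: (@quasi_fejer_le _ (fun t => dot (y t - z) (y t - z))).
  by move=> t; rewrite !mulr_ge0// subr_ge0.
by move=> t; exact: weighted_mean_descent.
Qed.

(** Otherwise the gap is at least [eps] from [M] on, so the weights [w t k] are dominated by the
    summable decrease of the quasi-Fejer inequality, against [w_div]. *)
Lemma weighted_mean_liminf z eps M : minimizer F z -> 0 < eps ->
  exists2 t, (M <= t)%N & F (y t) <= F z + eps.
Proof.
move=> zmin e0; apply: contrapT => noT; apply: w_div.
have gap t : (M <= t)%N -> eps <= F (y t) - F z.
  move=> Mt; rewrite lerBrDl leNgt; apply/negP => /ltW h.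
  by apply: noT; exists t.
apply: (bounded_psums_eventually (M := M) (c := eps^-1)
   (b := fun t => 2 * (w t k * (F (y t) - F z)))).
- by rewrite invr_ge0 ltW.
- by move=> t; rewrite !mulr_ge0// subr_ge0.
- move=> t /gap h; rewrite ler_pdivlMl//.
  have := ler_wpM2l (w_ge0 t k) h.
  by have := mulr_ge0 (w_ge0 t k) (le_trans (ltW e0) h); lra.
have [C eC] := descent_error_sum z.
exists (dot (y 0%N - z) (y 0%N - z) + C) => n.
have := weighted_mean_fejer zmin (leq0n n); have := eC n.
by have := le_trans (sqr_ge0 _) (sqr_norm_le_dot (y n - z)); lra.
Qed.

Lemma weighted_mean_cvg : (exists z, minimizer F z) ->
  exists2 p, minimizer F p &
    forall eps, 0 < eps -> exists M, forall t, (M <= t)%N -> `|y t - p| <= eps.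
Proof.
move=> [z zmin].
have /choice[u uP] n : exists t, (n <= t)%N /\ F (y t) <= F z + n.+1%:R^-1.
  have [|t nt Ft] := @weighted_mean_liminf z n.+1%:R^-1 n zmin.
    by rewrite invr_gt0 ltr0n.
  by exists t.
have [C eC] := descent_error_sum z.
pose K := `|z| + Num.sqrt (dot (y 0%N - z) (y 0%N - z) + C).
have yK t : `|y t| <= K.
  rewrite -[y t](subrK z) addrC (le_trans (ler_normD _ _))// lerD2l.
  rewrite -[`|_|]normr_id -sqrtr_sqr ler_wsqrtr//.
  apply: (le_trans (sqr_norm_le_dot _)).
  have := weighted_mean_fejer zmin (leq0n t); have := eC t.
  suff : 0 <= \sum_(0 <= s < t) 2 * (w s k * (F (y s) - F z)) by lra.
  by apply: sumr_ge0 => s _; rewrite !mulr_ge0// subr_ge0.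
have [p pP] := bounded_seq_cluster (fun n => yK (u n)).
have pmin : minimizer F p.
  move=> v; apply: (le_trans _ (zmin v)); apply/ler_addgt0Pr => e e0.
  (* Half of [e] covers the gap at [y (u n)], half the Lipschitz cost of moving to [p]; adding 1
     keeps the denominator positive. *)
  have c0 : 0 < N%:R * L + 1 by rewrite ltr_wpDl// mulr_ge0.
  have e20 : 0 < e / 2 by rewrite divr_gt0.
  have [M _ Mle] := near_infty_natSinv_lt (PosNum e20).
  have [n Mn pn] := pP (e / 2 / (N%:R * L + 1)) M (divr_gt0 e20 c0).
  have un : n.+1%:R^-1 <= e / 2 by apply/ltW; exact: Mle n Mn.
  have Fu := le_trans (uP n).2 (lerD (lexx _) un).
  have := F_lip p (y (u n)); rewrite distrC.
  move: pn; rewrite ler_pdivlMr// => pn.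
  have := normr_ge0 (y (u n) - p); lra.
exists p => // eps e0; have e2 : 0 < eps ^+ 2 / 2 by rewrite divr_gt0 ?exprn_gt0.
have [M eM] := bounded_psums_tail (descent_error_ge0 p) (descent_error_sum p) e2.
(* Half of [eps ^+ 2] is kept for the error tail, half for the Euclidean distance at time [u n]. The
   divisor [d.+1] replaces the [d] of [dot_self_le] to remain nonzero when [d = 0]. *)
have e3 : 0 < Num.sqrt (eps ^+ 2 / 2 / d.+1%:R) by rewrite sqrtr_gt0 divr_gt0.
have [n Mn pn] := pP _ M e3.
have un : dot (y (u n) - p) (y (u n) - p) <= eps ^+ 2 / 2.
  apply: (le_trans (dot_self_le _)).
  apply: (@le_trans _ _ (d.+1%:R * `|y (u n) - p| ^+ 2)).
    by rewrite ler_wpM2r ?sqr_ge0// ler_nat.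
  rewrite mulrC -ler_pdivlMr ?ltr0n//.
  have <- : Num.sqrt (eps ^+ 2 / 2 / d.+1%:R) ^+ 2 = eps ^+ 2 / 2 / d.+1%:R.
    by rewrite sqr_sqrtr// ltW// divr_gt0.
  by rewrite lerXn2r ?nnegrE.
exists (u n) => t ut.
have := weighted_mean_fejer pmin ut.
have := eM (u n) t (leq_trans Mn (uP n).1).
have : 0 <= \sum_(u n <= s < t) 2 * (w s k * (F (y s) - F p)).
  by apply: sumr_ge0 => s _; rewrite !mulr_ge0// subr_ge0.
have := sqr_norm_le_dot (y t - p) => h1 h2 h3 h4.
have : `|y t - p| ^+ 2 <= eps ^+ 2 by lra.
by rewrite ler_pXn2r ?nnegrE ?(ltW e0).
Qed.

Lemma subgradient_method_cvg : (exists z, minimizer F z) ->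
  exists p, minimizer F p /\ forall i, x t i @[t --> \oo] --> p.
Proof.
move=> /weighted_mean_cvg[p pmin yp]; exists p; split=> // i.
apply/cvgrPdist_le => /= eps e0; have e2 : 0 < eps / 2 by rewrite divr_gt0.
have [M1 hM1] := yp _ e2.
have [|M2 hM2] := bounded_psums_small _ diam_sum (exprn_gt0 2 e2).
  by move=> t; exact: sqr_ge0.
exists (maxn M1 M2) => // t /=; rewrite geq_max => /andP[/hM1 h1 /hM2 h2].
have h3 : diam (x t) <= eps / 2.
  by rewrite ler_pXn2r ?nnegrE ?diam_ge0 ?(ltW e2)// in h2.
have -> : p - x t i = - ((x t i - y t) + (y t - p)) by rewrite addrA subrK opprB.
rewrite normrN (le_trans (ler_normD _ _))//.
by have := dist_weighted_mean_le t i; lra.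
Qed.

End SubgradientMethod.

(** * From the hypotheses in arbitrary norms to the theorem *)

Lemma stepsize_sqr_bounded_psums (R : realType) (N : nat)
  (delta : nat -> 'I_N -> R) (nu : 'M[R]_N -> R) :
  is_norm nu -> submultiplicative nu -> (forall i t, 0 <= delta t i) ->
  (\sum_(0 <= t <oo)
      ((nu (stepsize_mx delta t))%:E *
       esups (fun l => (nu (stepsize_mx delta l))%:E) t) < +oo)%E ->
  bounded_psums (fun t => (\big[Num.max/0]_(i < N) delta t i) ^+ 2).
Proof.
move=> nuN nuM delta0 nu_sum; set n := fun t => nu (stepsize_mx delta t).
have n0 t : 0 <= n t by exact: is_norm_ge0.
suff : bounded_psums (fun t => n t ^+ 2).
  apply: bounded_psums_le => t; rewrite lerXn2r ?nnegrE ?bigmax_ge_id//.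
  apply: bigmax_le => // i _.
  by apply: le_trans (stepsize_le_norm delta t i nuN nuM); exact: ler_norm.
apply/nneseries_ltyP => [t|]; first exact: sqr_ge0.
apply: le_lt_trans nu_sum; apply: lee_nneseries => [t _ _|t _].
  by rewrite lee_fin sqr_ge0.
(* The supremum over [l >= t] includes [l = t], so each term of the series is at least
   [n t ^+ 2]. *)
rewrite expr2 EFinM lee_pmul// ?lee_fin//; apply: ereal_sup_ubound.
by exists t => //=.
Qed.

Theorem theorem4p1 (R : realType) (N d : nat) (hN : (1 <= N)%N) (hd : (1 <= d)%N)
  (f : 'I_N -> 'rV[R]_d -> R)
  (f_convex : forall i, convex_function [set: 'rV[R]_d] (f i))
  (f_bound : forall i, (subgradient_bound (f i) < +oo)%E)
  (f_min : exists z, minimizer (fun y => \sum_(i < N) f i y) z)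
  (P : nat -> 'M[R]_N) (P_stoch : forall t, row_stochastic (P t))
  (delta : nat -> 'I_N -> R)
  (x g : nat -> 'I_N -> 'rV[R]_d)
  (x_step : forall t i,
     x t.+1 i = \sum_(j < N) P t i j *: x t j - delta t i *: g t i)
  (g_sub : forall t i, subdifferential (f i) (x t i) (g t i))
  (normM : 'M[R]_N -> R) (normM_norm : is_norm normM)
  (normM_sub : submultiplicative normM)
  (normV : 'cV[R]_N -> R) (normV_norm : is_norm normV)
  (A1_inf : 0 < inf (range (fun t => min_pos_entry (P t))))
  (A1_pos : exists T : nat, forall t, positive_mx (backward_prod P (t + T) t))
  (A2_ge0 : forall i t, 0 <= delta t i)
  (A2_sum : (\sum_(0 <= t <oo)
      ((normM (stepsize_mx delta t))%:E *
       esups (fun l => (normM (stepsize_mx delta l))%:E) t) < +oo)%E)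
  (pi : nat -> 'cV[R]_N) (pi_abs : absolute_probability_vectors pi P)
  (A3_div : (\sum_(0 <= t <oo)
      (normV (stepsize_mx delta t *m pi t.+1))%:E = +oo)%E)
  (A3_sum : (\sum_(0 <= t <oo)
      (Num.sqrt t%:R * spread (fun i => pi t.+1 i 0 * delta t i))%:E < +oo)%E) :
  exists xstar : 'rV[R]_d,
    minimizer (fun y => \sum_(i < N) f i y) xstar /\
    forall i, x t i @[t --> \oo] --> xstar.
Proof.
have [L L0 fL] : exists2 L, 0 <= L &
    forall i z h, subdifferential (f i) z h -> norm1 h <= L.
  have /choice[l lP] i : exists l, 0 <= l /\
      forall z h, subdifferential (f i) z h -> norm1 h <= l.
    by have [l l0 fl] := subgradient_boundP (f_bound i); exists l.
  (* The sum of the nonnegative individual bounds serves as a common bound. *)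
  exists (\sum_i l i) => [|i z h hz]; first by apply: sumr_ge0 => i _; exact: (lP i).1.
  apply: (le_trans ((lP i).2 z h hz)); rewrite (bigD1 i)//= lerDl.
  by apply: sumr_ge0 => j _; exact: (lP j).1.
pose k : 'I_N := Ordinal hN.
pose D t := \big[Num.max/0]_(i < N) delta t i.
pose w t i := pi t.+1 i 0 * delta t i.
have w0 t i : 0 <= w t i by rewrite mulr_ge0//; exact: (pi_abs.1 _).1.
have D0 t : 0 <= D t by exact: bigmax_ge_id.
have D_sum : bounded_psums (fun t => D t ^+ 2).
  exact: stepsize_sqr_bounded_psums normM_norm normM_sub A2_ge0 A2_sum.
have spread0 t : 0 <= spread (w t) by exact: bigmax_ge_id.
have spread_sum : bounded_psums (fun t => Num.sqrt t%:R * spread (w t)).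
  by apply/nneseries_ltyP => // t; rewrite mulr_ge0// sqrtr_ge0.
pose p := inf (range (fun t => min_pos_entry (P t))).
have Pp t i j : 0 < P t i j -> p <= P t i j.
  move=> /min_pos_entry_le; apply: le_trans; apply: ge_inf; last by exists t.
  by exists 0 => _ [s _ <-]; exact: min_pos_entry_ge0.
have diam_sum : bounded_psums (fun t => diam (x t) ^+ 2).
  have [T PT] := A1_pos.
  apply: (diam_sqr_bounded_psums (u := fun t i => delta t i *: g t i)
    (b := fun t => L * D t) P_stoch x_step _ A1_inf Pp PT) => [t i|t|].
  - rewrite normrZ ger0_norm// mulrC ler_pM//.
      by apply: le_trans (norm_le_norm1 _) (fL _ _ _ (g_sub t i)).
    exact: (le_bigmax 0 (delta t)).
  - by rewrite mulr_ge0.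
  - apply: bounded_psums_le (bounded_psumsZ (sqr_ge0 L) D_sum) => t.
    by rewrite exprMn.
(* If the weights of index [k] were summable, those of every index would be, differing from them by
   at most the spread; [is_norm_le_max] would then make the series in [A3_div] finite. *)
have w_div : ~ bounded_psums (fun t => w t k).
  move=> w_sum; have [c c0 cP] := is_norm_le_max normV_norm.
  have spread_sum' : bounded_psums (fun t => spread (w t)).
    apply: (bounded_psums_eventually (M := 1) (c := 1) _ _ _ spread_sum) => // t.
      by rewrite mulr_ge0// sqrtr_ge0.
    move=> t1; rewrite mul1r -[leLHS]mul1r ler_wpM2r//.
    by rewrite -[X in X <= _]sqrtr1 ler_wsqrtr// ler1n.
  have : bounded_psums (fun t => normV (stepsize_mx delta t *m pi t.+1)).
    apply: bounded_psums_le (bounded_psumsZ c0 (bounded_psumsD w_sum spread_sum')) => t.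
    apply: cP => i.
    rewrite mul_diag_mx !mxE mulrC ger0_norm; last exact: w0.
    have := le_bigmax2 (fun i j => `|w t i - w t j|) i k.
    rewrite -/(w t i) -/(spread (w t)) => /(le_trans (ler_norm _)).
    by rewrite lerBlDl.
  move=> /nneseries_ltyP; rewrite A3_div => /(_ (fun t => is_norm_ge0 normV_norm _)).
  by rewrite ltxx.
exact: (subgradient_method_cvg f_convex L0 fL P_stoch x_step g_sub A2_ge0 pi_abs
  D_sum diam_sum spread_sum w_div f_min).
Qed.
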